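(* For every integer $n\geq 10$ with $n\equiv 1 \pmod 3$, there exists a graph of order $n$ with exactly $2n-5$ edges and maximum degree $(n-1)/3$ which is both hypohamiltonian and $K_2$-hamiltonian.
   Context: All graphs are finite, simple and connected. A graph is hamiltonian if it has a cycle through all its vertices. A graph is hypohamiltonian if it is not hamiltonian but $G-v$ is hamiltonian for every vertex $v$. A graph $G$ is $K_2$-hamiltonian if for every pair of adjacent vertices $u,v$ the graph $G-u-v$ is hamiltonian. *)

(* Defs.v *)
From mathcomp Require Import all_boot.

Set Implicit Arguments.
Unset Strict Implicit.
Unset Printing Implicit Defensive.

Record sgraph := SGraph {
  vertex :> finType;
  adj : rel vertex;
  adj_sym : symmetric adj;
  adj_irrefl : irreflexive adj
}.

Definition edges (G : sgraph) : {set {set G}} :=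
  [set A | [exists x : G, exists y : G, adj x y && (A == [set x; y])]].

Definition degree (G : sgraph) (x : G) : nat := #|[set y | adj x y]|.

Definition max_degree (G : sgraph) : nat := \max_(x : G) degree x.

Definition connected_graph (G : sgraph) : Prop :=
  0 < #|G| /\ forall x y : G, connect (@adj G) x y.

Definition induced_adj (G : sgraph) (A : {set G}) : rel {x : G | x \in A} :=
  fun x y => adj (val x) (val y).

Lemma induced_adj_sym (G : sgraph) (A : {set G}) : symmetric (@induced_adj G A).
Proof. by move=> x y; apply: adj_sym. Qed.

Lemma induced_adj_irrefl (G : sgraph) (A : {set G}) :
  irreflexive (@induced_adj G A).
Proof. by move=> x; apply: adj_irrefl. Qed.

Definition induced (G : sgraph) (A : {set G}) : sgraph :=
  SGraph (@induced_adj_sym G A) (@induced_adj_irrefl G A).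

(* The size condition is needed: [path.cycle] accepts the empty sequence and,
   by symmetry of [adj], two adjacent vertices [:: x; y]. *)
Definition hamiltonian (G : sgraph) : Prop :=
  exists c : seq G,
    [/\ 2 < size c, cycle (@adj G) c, uniq c & forall x : G, x \in c].

Definition hypohamiltonian (G : sgraph) : Prop :=
  ~ hamiltonian G /\ forall v : G, hamiltonian (induced [set~ v]).

Definition K2_hamiltonian (G : sgraph) : Prop :=
  forall u v : G, adj u v -> hamiltonian (induced (~: [set u; v])).

(* Main.v *)
Require Import Defs.
From mathcomp Require Import all_boot all_algebra.
From mathcomp Require Import zify.

(** For [m >= 0] take a cycle of length [3 m + 6], three hubs, the [r]-th one
    joined to the cycle vertices of index [r] mod 3, and an apex joined to the
    three hubs; [m = 0] gives the Petersen graph.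

    A hamiltonian cycle would read apex, P, A, R, B, Q with P, Q, R the three
    hubs and A, B two paths partitioning the rim cycle.  Both rim edges between
    A and B join an endpoint of A to an endpoint of B; consecutive rim vertices
    lie under distinct hubs, and comparing residues mod 3 along these two edges
    forces P = Q.

    The hamiltonian cycles of the vertex-deleted subgraphs are explicit; by
    rotation a single base index [i] suffices to describe them. *)

Set Implicit Arguments.
Unset Strict Implicit.
Unset Printing Implicit Defensive.

Import GRing.Theory.

(** * General facts on finite graphs *)

Lemma induced_hamiltonian (G : sgraph) (A : {set G}) (c : seq G) :
    2 < #|A| -> cycle (@adj G) c -> {subset A <= c} -> size c = #|A| ->
  hamiltonian (induced A).
Proof.
move=> A_gt2 cyc_c sAc size_c.
(* Pigeonhole: a sequence covering [A] with exactly [#|A|] entries has no room for a repetition or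
   for a vertex outside [A]. This spares any check of distinctness on the explicit cycles. *)
have size_le : size c <= size (enum A) by rewrite -cardE size_c.
have sAc' : {subset enum A <= c} by move=> x; rewrite mem_enum => /sAc.
have uniq_c := leq_size_uniq (enum_uniq A) sAc' size_le.
have [_ eqAc] := uniq_min_size (enum_uniq A) sAc' size_le.
pose c' : seq (induced A) := pmap insub c.
have def_c : map val c' = c.
  rewrite (pmap_filter (@insubK _ _ _)); apply/all_filterP/allP => x.
  by rewrite -eqAc mem_enum => xA; rewrite insubT.
exists c'; split.
- by rewrite -(size_map val) def_c size_c.
- by move: cyc_c; rewrite -{1}def_c cycle_map.
- by rewrite -(map_inj_uniq val_inj) def_c.
- move=> x; rewrite -(mem_map val_inj) def_c -eqAc mem_enum; exact: valP.
Qed.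

(** Double counting of ordered adjacent pairs: grouped by underlying edge, each fibre consists of a
    pair and its swap, distinct by irreflexivity. *)
Lemma sum_degree (G : sgraph) : \sum_(x : G) degree x = 2 * #|edges G|.
Proof.
have -> : \sum_(x : G) degree x = \sum_(p : G * G | adj p.1 p.2) 1.
  rewrite -(pair_big_dep xpredT (@adj G) (fun _ _ => 1)) /=.
  apply: eq_bigr => x _; rewrite sum1_card /degree cardsE.
  by apply: eq_card.
rewrite (partition_big (fun p : G * G => [set p.1; p.2]) [in edges G]) /=; last first.
  move=> [x y] /= xy; rewrite inE; apply/existsP; exists x.
  by apply/existsP; exists y; rewrite xy /=.
rewrite mulnC -sum_nat_const; apply: eq_bigr => A.
rewrite inE => /existsP[x /existsP[y /andP[xy /eqP->]]].
have neq_adj (u v : G) : adj u v -> u != v.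
  by move=> uv; apply/eqP => euv; rewrite euv adj_irrefl in uv.
rewrite sum1_card (@eq_card _ _ (pred2 (x, y) (y, x))); last first.
  move=> [u v]; rewrite !inE /= !xpair_eqE.
  apply/andP/orP => [[uv /eqP e]|]; last first.
    by case=> /andP[/eqP-> /eqP->]; rewrite ?[adj y x]adj_sym // setUC.
  have := set21 u v; have := set22 u v; rewrite e !inE.
  have := neq_adj _ _ uv.
  by case/boolP: (u == x) => [/eqP->|_ /= nuv vxy /eqP uy];
    [rewrite eq_sym => /negPf-> /= -> _; left
    |move: vxy; rewrite uy eq_sym in nuv *; rewrite (negPf nuv) orbF eqxx => ->; right].
by rewrite card2 xpair_eqE (negPf (neq_adj _ _ xy)).
Qed.

(** * The graph and its modular coordinates *)

Section Graph.
Variable m : nat.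
(** The visible double successor equips ['I_N] with the ring structure of the integers mod N; the
    rim successor is then addition of 1. *)
Notation N := (3 * m + 4).+2.
Notation rim := 'I_N.
Notation vert := (option ('I_3 + rim)).

Definition res (i : rim) : 'I_3 := (i : nat)%:R%R.

(** Reduction mod N does not disturb residues mod 3, because 3 divides N. *)
Lemma res_nat (j : nat) : res (j%:R)%R = (j%:R)%R.
Proof.
rewrite /res; apply: val_inj; rewrite !Zp_nat /=.
by rewrite modn_dvdm //; lia.
Qed.

Lemma resS (i : rim) : res (i + 1)%R = (res i + 1)%R.
Proof. by rewrite -{1}[i]natr_Zp natr1 res_nat /res natr1. Qed.

(* [None] is the apex, [inl] tags the hubs and [inr] the rim vertices. *)
Definition vadj (x y : vert) : bool :=
  match x, y with
  | None, Some (inl _) | Some (inl _), None => true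
  | Some (inl r), Some (inr i) | Some (inr i), Some (inl r) => res i == r
  | Some (inr i), Some (inr j) => (j == i + 1)%R || (i == j + 1)%R
  | _, _ => false
  end.

Lemma vadj_sym : symmetric vadj.
Proof. by move=> [[r|i]|] [[s|j]|] //=; rewrite orbC. Qed.

Lemma vadj_irrefl : irreflexive vadj.
Proof.
move=> [[r|i]|] //=; rewrite orbb -{1}[i]addr0 (inj_eq (addrI i)).
by rewrite eq_sym oner_eq0.
Qed.

Definition trihub : sgraph := SGraph vadj_sym vadj_irrefl.

Definition apex : trihub := None.
Definition hub (j : nat) : trihub := Some (inl (j%:R)%R).
Definition rimv (j : nat) : trihub := Some (inr (j%:R)%R).
Definition run (a l : nat) : seq trihub := [seq rimv j | j <- iota a l].

Lemma adj_rimS (j : nat) : adj (rimv j) (rimv j.+1).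
Proof. by rewrite /= natr1 eqxx. Qed.

Lemma adj_Srim (j : nat) : adj (rimv j.+1) (rimv j).
Proof. by rewrite adj_sym adj_rimS. Qed.

Lemma adj_hub_rim (j k : nat) : j = k %[mod 3] -> adj (hub j) (rimv k).
Proof.
by move=> jk; rewrite /= res_nat; apply/eqP/val_inj; rewrite !Zp_nat /= -jk.
Qed.

Lemma adj_rim_hub (j k : nat) : j = k %[mod 3] -> adj (rimv k) (hub j).
Proof. by move/adj_hub_rim; rewrite adj_sym. Qed.

Lemma path_run (x : trihub) (a l : nat) :
  0 < l -> path (@adj trihub) x (run a l) = adj x (rimv a).
Proof.
case: l => //= l _; rewrite andb_idr // => _.
by elim: l a => //= l IH a; rewrite natr1 eqxx; apply: IH.
Qed.

Lemma last_run (x : trihub) (a l : nat) :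
  0 < l -> last x (run a l) = rimv (a + l.-1).
Proof.
case: l => //= l _; elim: l a => [|l IH] a; rewrite ?addn0 //.
by rewrite -(addSnnS a l) -IH.
Qed.

Lemma mem_run (a l j : nat) : a <= j < a + l -> rimv j \in run a l.
Proof. by move=> j_al; apply: map_f; rewrite mem_iota. Qed.

Lemma size_run (a l : nat) : size (run a l) = l.
Proof. by rewrite size_map size_iota. Qed.

(* Rim and hub indices are read from the base point [i], so that the cycles
   below need no case analysis modulo [3 m + 6]. *)
Variant vertex_spec (i : nat) : trihub -> Type :=
  | VertexApex : vertex_spec i apex
  | VertexHub k of k < 3 : vertex_spec i (hub (k + i))
  | VertexRim k of k < N : vertex_spec i (rimv (k + i)).

Lemma vertexP (i : nat) (x : trihub) : vertex_spec i x.
Proof.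
have natrDB p (r : 'I_p.+2) : r = (((r - i%:R)%R + i)%:R)%R.
  by rewrite natrD natr_Zp subrK.
case: x => [[r|j]|]; last exact: VertexApex.
- by rewrite [r]natrDB; apply: VertexHub.
- by rewrite [j]natrDB; apply: VertexRim.
Qed.

(** * Order, connectedness and degrees *)

Lemma card_trihub : #|trihub| = 3 * m + 10.
Proof. rewrite card_option card_sum !card_ord; lia. Qed.

Lemma trihub_connected : connected_graph trihub.
Proof.
have to_apex x : connect (@adj trihub) x apex.
  have hub_apex j : connect (@adj trihub) (hub j) apex by apply: connect1.
  case: (vertexP 0 x) => [|k _|k _] //.
  by apply: connect_trans (hub_apex (k + 0)); apply/connect1/adj_rim_hub.
split=> [|x y]; first by rewrite card_trihub addnS.
apply: connect_trans (to_apex x) _.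
by rewrite sym_connect_sym //; apply: adj_sym.
Qed.

Lemma degree_apex : degree apex = 3.
Proof.
rewrite -[RHS](card_ord 3) -cardsT
  -(card_imset _ (inj_comp (@Some_inj _) (@inl_inj _ rim))).
apply: eq_card => -[[r|j]|]; rewrite !inE /=; apply/esym.
- by apply/imsetP; exists r.
- by apply/negP => /imsetP[].
- by apply/negP => /imsetP[].
Qed.

Lemma card_res (r : 'I_3) : #|[set i | res i == r]| = m.+2.
Proof.
pose f (k : 'I_m.+2) : rim := ((r + 3 * k)%:R)%R.
have val_f k : f k = r + 3 * k :> nat.
  by rewrite /f Zp_nat /= modn_small //; have := ltn_ord k; have := ltn_ord r; lia.
have f_inj : injective f.
  by move=> k l /(congr1 val); rewrite /= !val_f => kl; apply: val_inj => /=; lia.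
rewrite -[RHS]card_ord -cardsT -(card_imset _ f_inj); apply: eq_card => i.
rewrite inE; apply/eqP/imsetP => [res_i|[k _ ->]].
  have ltk : i %/ 3 < m.+2 by have := ltn_ord i; lia.
  exists (Ordinal ltk) => //; apply: val_inj; rewrite /= val_f -res_i /res Zp_nat /=; lia.
by rewrite /res val_f; apply: val_inj; rewrite Zp_nat /=; have := ltn_ord r; lia.
Qed.

Lemma degree_hub (j : nat) : degree (hub j) = m + 3.
Proof.
have inr_inj' := inj_comp (@Some_inj _) (@inr_inj 'I_3 rim).
rewrite addn3 -(card_res (j%:R)%R) -(card_imset _ inr_inj') -add1n.
set S := [set _ | _ in _]; have apexS : apex \notin S by apply/imsetP=> -[].
transitivity #|apex |: S|; last by rewrite cardsU1 apexS.
apply: eq_card => -[[r|i]|]; rewrite !inE //=.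
- by apply/esym/negP => /imsetP[].
- by rewrite (mem_imset _ _ inr_inj') inE.
Qed.

Lemma rim_succ_neq_pred (i : rim) : (i + 1 != i - 1)%R.
Proof.
apply/eqP => /(congr1 (fun k => k + 1)%R); rewrite subrK -addrA -[RHS]addr0.
by move/addrI/(congr1 val) => /=; rewrite !modn_small //; lia.
Qed.

Lemma degree_rim (j : nat) : degree (rimv j) = 3.
Proof.
pose i : rim := (j%:R)%R; pose u : trihub := Some (inr (i + 1)%R).
pose v : trihub := Some (inr (i - 1)%R).
have <- : #|hub j |: [set u; v]| = 3.
  by rewrite cardsU1 !inE /= cards2 -[u == v]/(_ == _ :> rim) rim_succ_neq_pred.
apply: eq_card => -[[r|k]|]; rewrite !inE //=.
- by rewrite res_nat orbF eq_sym.
- by rewrite -[(j%:R)%R]/i -[Some _ == u]/(k == _) -[Some _ == v]/(k == _)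
    [k == (i - 1)%R]eq_sym subr_eq.
Qed.

(** * Explicit hamiltonian cycles after deleting a vertex or an edge's two ends *)

Lemma induced1_hamiltonian (v : trihub) (c : seq trihub) :
    cycle (@adj trihub) c -> (forall x, x != v -> x \in c) ->
  size c = 3 * m + 9 -> hamiltonian (induced [set~ v]).
Proof.
move=> cyc_c sub_c size_c.
have cardv : #|[set~ v]| = 3 * m + 9 by rewrite cardsC1 card_trihub addnS.
apply: (induced_hamiltonian _ cyc_c) => [|x|]; rewrite ?cardv //; first by rewrite !addnS.
by rewrite !inE; apply: sub_c.
Qed.

Lemma induced2_hamiltonian (u v : trihub) (c : seq trihub) :
    u != v -> cycle (@adj trihub) c -> (forall x, x != u -> x != v -> x \in c) ->
  size c = 3 * m + 8 -> hamiltonian (induced (~: [set u; v])).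
Proof.
move=> nuv cyc_c sub_c size_c.
have carduv : #|~: [set u; v]| = 3 * m + 8.
  by rewrite cardsCs setCK card_trihub cards2 nuv /=; lia.
apply: (induced_hamiltonian _ cyc_c) => [|x|]; rewrite ?carduv //; first by rewrite !addnS.
by rewrite !inE negb_or => /andP[]; apply: sub_c.
Qed.

Arguments adj : simpl never.

Ltac cycle_tac :=
  rewrite /= ?rcons_cat -?cats1 /= ?cat_path ?path_run ?last_run /= ?adj_rimS ?adj_Srim
          ?adj_hub_rim ?adj_rim_hub //; try lia.

(** Relative to the base point, the cycles below list rim vertices individually only at offsets
    under 4; all larger offsets lie in the [run]. Hence the finite case split. *)
Ltac cover_tac i :=
  let x := fresh in let k := fresh in let ltk := fresh in
  move=> x; case: (vertexP i x) => [|[|[|[|k]]] // _|[|[|[|[|k]]]] ltk];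
  rewrite ?(add0n, addSn) ?eqxx // ?(inE, mem_cat) ?eqxx ?orbT // ?mem_run ?orbT //; lia.

Ltac size_tac := rewrite /= ?size_cat size_run /=; lia.

Lemma ham_del_apex : hamiltonian (induced [set~ apex]).
Proof.
apply: (@induced1_hamiltonian _ ([:: hub 0; rimv 0; rimv 1; hub 1] ++
  run 4 (3 * m + 2) ++ [:: hub 2; rimv 2; rimv 3])).
- cycle_tac.
- cover_tac 0.
- size_tac.
Qed.

(** One tour of the whole rim from [i] ends at residue [i + 2], so it uses the hubs [i] and [i.+2]
    and skips the one between; hence the deleted hub is written [hub i.+1]. *)
Lemma ham_del_hub (i : nat) : hamiltonian (induced [set~ hub i.+1]).
Proof.
apply: (@induced1_hamiltonian _ ([:: apex; hub i] ++ run i (3 * m + 6) ++ [:: hub i.+2])).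
- cycle_tac.
- cover_tac i.
- size_tac.
Qed.

Lemma ham_del_rim (i : nat) : hamiltonian (induced [set~ rimv i]).
Proof.
apply: (@induced1_hamiltonian _
  ([:: apex; hub i; rimv i.+3; rimv i.+2; rimv i.+1; hub i.+1]
  ++ run i.+4 (3 * m + 2) ++ [:: hub i.+2])).
- cycle_tac.
- cover_tac i.
- size_tac.
Qed.

Lemma ham_del_apex_hub (i : nat) : hamiltonian (induced (~: [set apex; hub i.+1])).
Proof.
apply: (@induced2_hamiltonian _ _
  ([:: hub i.+2; rimv i.+2; rimv i.+1; rimv i; hub i]
  ++ run i.+3 (3 * m + 3))) => //.
- cycle_tac.
- cover_tac i.
- size_tac.
Qed.

Lemma ham_del_hub_rim (i : nat) : hamiltonian (induced (~: [set hub i; rimv i])).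
Proof.
apply: (@induced2_hamiltonian _ _ ([:: apex; hub i.+1] ++
  run i.+1 (3 * m + 5) ++ [:: hub i.+2])) => //.
- cycle_tac.
- cover_tac i.
- size_tac.
Qed.

Lemma ham_del_rim_rim (i : nat) : hamiltonian (induced (~: [set rimv i; rimv i.+1])).
Proof.
apply: (@induced2_hamiltonian _ _ ([:: apex; hub i.+1] ++ run i.+4 (3 * m + 2)
  ++ [:: hub i.+2; rimv i.+2; rimv i.+3; hub i])).
- by apply/eqP => e; have := adj_rimS i; rewrite -e adj_irrefl.
- cycle_tac.
- cover_tac i.
- size_tac.
Qed.

(** * Non-hamiltonicity *)

Definition rim_adj (i j : rim) : bool := (j == i + 1)%R || (i == j + 1)%R.

(** An interior vertex has a predecessor and a successor on the path, distinct by uniqueness, and a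
    rim vertex has only two rim neighbours. *)
Lemma path_rim_interior (x u : rim) (t : seq rim) :
    uniq (x :: t) -> path rim_adj x t -> u \in x :: t -> u != x -> u != last x t ->
  (u + 1)%R \in x :: t /\ (u - 1)%R \in x :: t.
Proof.
move=> uniq_t path_t; rewrite inE => /orP[/eqP-> /eqP//|ut].
case/splitPr: t / ut uniq_t path_t => p [|b q] uniq_t; rewrite cat_path last_cat /= ?eqxx //.
set a := last x p => /and4P[_ au ub _] _ _.
have a_in : a \in x :: p by apply: mem_last.
have neq_ab : a != b.
  apply/eqP => ab; move: uniq_t; rewrite -cat_cons cat_uniq => /and3P[_ /hasPn/(_ b) /=].
  by rewrite -ab a_in inE mem_head orbT => /(_ isT).
have [aS bS] : a \in x :: p ++ [:: u, b & q] /\ b \in x :: p ++ [:: u, b & q].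
  by rewrite -!cat_cons !mem_cat a_in !inE eqxx !orbT.
have prevE v : (u == v + 1)%R = (v == u - 1)%R by rewrite [RHS]eq_sym subr_eq.
move: au ub neq_ab; rewrite /rim_adj !prevE => /orP[] /eqP<- /orP[] /eqP bE //.
- by rewrite -bE.
- by rewrite bE eqxx.
- by rewrite bE eqxx.
- by rewrite -bE.
Qed.

Lemma path_rim_end (x u : rim) (t : seq rim) :
    path rim_adj x t -> u \in x :: t -> x != last x t ->
  (u + 1)%R \in x :: t \/ (u - 1)%R \in x :: t.
Proof.
move=> path_t u_in nx.
suff [v v_in] : exists2 v, v \in x :: t & rim_adj u v.
  by case/orP=> /eqP uv; [left; rewrite -uv|right; rewrite uv addrK].
move: u_in; rewrite inE => /orP[/eqP->|u_in].
  case: t path_t nx => [|b q] /=; first by rewrite eqxx.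
  by case/andP=> xb _ _; exists b; rewrite // !inE eqxx orbT.
case/splitPr: t / u_in path_t nx => p q; rewrite cat_path /= => /and3P[_ pu _] _.
by exists (last x p); rewrite 1?/rim_adj 1?orbC // -cat_cons mem_cat mem_last.
Qed.

(** Otherwise [S] would be closed under adding 1, which generates the whole rim from [x]. *)
Lemma rim_boundary (S : seq rim) (x y : rim) :
  x \in S -> y \notin S -> exists2 i, i \in S & (i + 1)%R \notin S.
Proof.
move=> xS; have [/existsP[i /andP[iS i1S]] _|/existsPn closedS] :=
  boolP [exists i, (i \in S) && ((i + 1)%R \notin S)]; first by exists i.
have addS k : (x + k%:R)%R \in S.
  elim: k => [|k IH]; first by rewrite addr0.
  by move: (closedS (x + k%:R)%R); rewrite IH negbK -addrA natr1.
by case/negP; have := addS (y - x)%R; rewrite natr_Zp addrC subrK.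
Qed.

Lemma rim_arcs_false (x y : rim) (t1 t2 : seq rim) :
    path rim_adj x t1 -> path rim_adj y t2 -> uniq ((x :: t1) ++ (y :: t2)) ->
    (forall i, i \in (x :: t1) ++ (y :: t2)) ->
    res (last x t1) = res y -> res x != res y -> res y != res (last y t2) ->
  res x != res (last y t2) -> False.
Proof.
move=> path1 path2; rewrite cat_uniq => /and3P[uniq1 /hasPn disj uniq2] cover.
set S1 := x :: t1 in uniq1 disj cover *; set S2 := y :: t2 in uniq2 disj cover *.
set e := last x t1; set w := last y t2 => res_e nxy nyw nxw.
have notin1 i : i \notin S1 -> i \in S2 by have := cover i; rewrite mem_cat => /orP[->|].
have notin2 i : i \in S1 -> i \notin S2 by move=> i1; apply/negP => /disj; rewrite i1.
have neq_res i j : res i != res j -> i != j by apply: contraNneq => ->.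
have nxe : x != e by apply: neq_res; rewrite res_e.
have nyw' : y != w by apply: neq_res.
(* Going round the rim, the edge from [i] leaves the first arc and the edge from [j] leaves the
   second. An interior vertex of an arc has both rim neighbours on that arc, so all four ends of
   these edges are ends of arcs. *)
have [i i1 Si] := rim_boundary (mem_head x t1) (disj y (mem_head y t2)).
have [j j2 Sj] := rim_boundary (mem_head y t2) (notin2 x (mem_head x t1)).
have Si2 := notin1 _ Si.
have Sj1 : (j + 1)%R \in S1 by apply: contraR Sj => /notin1.
have i_end : i = x \/ i = e.
  have [->|ni] := eqVneq i x; first by left.
  have [->|ni'] := eqVneq i e; first by right.
  by have [] := path_rim_interior uniq1 path1 i1 ni ni'; rewrite (negPf Si).
have j_end : j = y \/ j = w.
  have [->|nj] := eqVneq j y; first by left.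
  have [->|nj'] := eqVneq j w; first by right.
  by have [] := path_rim_interior uniq2 path2 j2 nj nj'; rewrite (negPf Sj).
have i1_end : (i + 1 = y)%R \/ (i + 1 = w)%R.
  have [->|ni] := eqVneq (i + 1)%R y; first by left.
  have [->|ni'] := eqVneq (i + 1)%R w; first by right.
  have [_] := path_rim_interior uniq2 path2 Si2 ni ni'.
  by rewrite addrK (negPf (notin2 _ i1)).
have j1_end : (j + 1 = x)%R \/ (j + 1 = e)%R.
  have [->|nj] := eqVneq (j + 1)%R x; first by left.
  have [->|nj'] := eqVneq (j + 1)%R e; first by right.
  have [_] := path_rim_interior uniq1 path1 Sj1 nj nj'.
  by rewrite addrK => /notin2; rewrite j2.
(* If the two crossing edges met, the arc containing their common vertex would
   be a singleton. *)
have nij : i != (j + 1)%R.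
  apply/eqP => ij; have := path_rim_end path1 i1 nxe.
  by rewrite (negPf Si) ij addrK => -[//|/notin2]; rewrite j2.
have nji : j != (i + 1)%R.
  apply/eqP => ji; have := path_rim_end path2 j2 nyw'.
  by rewrite (negPf Sj) ji addrK (negPf (notin2 _ i1)) => -[].
have neq_succ (r : 'I_3) : (r + 1)%R != r.
  by rewrite -[X in _ != X]addr0 (inj_eq (addrI r)) oner_eq0.
have ri := resS i; have rj := resS j.
(* Four matchings of the arc ends survive. If an edge joins [last x t1] to [y], their common residue
   equals its own successor. Otherwise the edges join [x] to [y] and [last x t1] to [last y t2], so
   [x] and [last y t2] both lie one below, or both one above, that common residue. *)
case: i_end j1_end i1_end j_end => iE [] j1E [] i1E [] jE;
  do ?[by rewrite iE j1E eqxx in nij | by rewrite jE i1E eqxx in nji];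
  move: ri rj; rewrite i1E j1E iE jE ?res_e.
- by move=> -> /addIr dE; rewrite dE eqxx in nxw.
- by move=> _ /esym/eqP; rewrite (negPf (neq_succ _)).
- by move=> /esym/eqP; rewrite (negPf (neq_succ _)).
- by move=> dE aE; rewrite dE aE eqxx in nxw.
Qed.

Lemma hubs_exhaust (p q : 'I_3) : p != q ->
  exists r, [/\ r != p, r != q & forall s, [|| s == p, s == q | s == r]].
Proof.
move=> npq; have /card_gt0P[r] : 0 < #|~: [set p; q]|.
  by rewrite cardsCs setCK card_ord cards2 npq.
rewrite !inE negb_or => /andP[rp rq]; exists r; split=> // s.
have : [set p; q; r] == [set: 'I_3].
  by rewrite eqEcard subsetT cardsT card_ord setUC cardsU1 !inE negb_or rp rq cards2 npq.
by move/eqP/setP/(_ s); rewrite !inE -orbA => ->.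
Qed.

Definition rim_vertex (i : rim) : trihub := Some (inr i).

Lemma map_rim_vertex (s : seq trihub) :
  (forall v, v \in s -> exists i, v = rim_vertex i) -> exists t, s = map rim_vertex t.
Proof.
elim: s => [|v s IH] vs; first by exists [::].
have [i ->] := vs v (mem_head v s).
have [w ws|t ->] := IH; first by apply: vs; rewrite inE ws orbT.
by exists (i :: t).
Qed.

Lemma trihub_nonhamiltonian : ~ hamiltonian trihub.
Proof.
case=> c [size_c cycle_c uniq_c mem_c].
have [i s rot_c] := rot_to (mem_c apex).
have mem_s v : v \in apex :: s by rewrite -rot_c mem_rot.
move: size_c uniq_c cycle_c; rewrite -(size_rot i) -(rot_uniq i) -(rot_cycle i) rot_c.
(* With the apex rotated to the front, the first and last remaining vertices are its neighbours,
   hence hubs; the size bound makes them separate entries. *)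
case: s {rot_c} mem_s => [|[[p|?]|] s] //=; case/lastP: s => [|s [[q|?]|]] //=;
  rewrite ?rcons_path ?last_rcons ?andbF //.
move=> mem_s _; rewrite !inE mem_rcons rcons_uniq !inE /= mem_rcons inE negb_or.
move=> /and4P[apex_s /andP[npq p_s] q_s uniq_s] /andP[/andP[path_s last_q] _].
have {}npq : p != q by [].
have {}mem_s v : [|| v == apex, v == Some (inl p), v == Some (inl q) | v \in s].
  by have := mem_s v; rewrite !inE mem_rcons inE.
have [r [nrp nrq hubsP]] := hubs_exhaust npq.
have r_s : (Some (inl r) : trihub) \in s.
  have := mem_s (Some (inl r)).
  by rewrite -![Some (inl r) == Some _]/(r == _) (negPf nrp) (negPf nrq).
(* The third hub cuts the remaining sequence into two pieces, which can only contain rim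
   vertices. *)
case/splitPr: s / r_s apex_s p_s q_s uniq_s path_s last_q mem_s => s1 s2.
rewrite !mem_cat !inE !negb_or => /and3P[apex1 _ apex2] /and3P[p1 _ p2] /and3P[q1 _ q2].
rewrite cat_uniq cat_path last_cat /= => /and4P[uniq1 disj r2 uniq2].
move: disj; rewrite negb_or => /andP[r1 disj] /and3P[path1 adj1 path2] last_q mem_s.
have rim_of (S : seq trihub) v : apex \notin S -> Some (inl p) \notin S ->
    Some (inl q) \notin S ->
    Some (inl r) \notin S -> v \in S -> exists i, v = rim_vertex i.
  move=> aS pS qS rS; case: v => [[h|j]|] vS; last by rewrite vS in aS.
    by case/or3P: (hubsP h) => /eqP hE; rewrite -hE vS in pS qS rS.
  by exists j.
have [t1 s1E] := map_rim_vertex (fun v => @rim_of s1 v apex1 p1 q1 r1).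
have [t2 s2E] := map_rim_vertex (fun v => @rim_of s2 v apex2 p2 q2 r2).
have rim_vertex_inj : injective rim_vertex by move=> j k [].
have pathE j t : path (@adj trihub) (rim_vertex j) (map rim_vertex t) = path rim_adj j t.
  by rewrite path_map.
have uniq12 : uniq (t1 ++ t2).
  by rewrite -(map_inj_uniq rim_vertex_inj) map_cat -s1E -s2E cat_uniq uniq1 disj.
have cover j : j \in t1 ++ t2.
  by have := mem_s (rim_vertex j);
    rewrite -(mem_map rim_vertex_inj) map_cat -s1E -s2E !mem_cat inE.
move: path1 adj1 path2 last_q; rewrite s1E s2E.
(* Neither piece is empty, since two hubs are never adjacent. *)
case: t1 t2 uniq12 cover {s1E s2E} => [|x t1] [|y t2] //= uniq12 cover.
rewrite !pathE !last_map => /andP[/eqP px path1] /eqP er /andP[/eqP ry path2] /eqP wq.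
by apply: (rim_arcs_false path1 path2); rewrite ?px ?er ?ry ?wq // eq_sym.
Qed.

(** * Assembling the properties of the graph *)

Lemma hubP (r : 'I_3) : exists i, Some (inl r) = hub i.+1.
Proof. by exists (r - 1)%R; rewrite /hub -natr1 natr_Zp subrK. Qed.

Lemma rimP (j : rim) : Some (inr j) = rimv j.
Proof. by rewrite /rimv natr_Zp. Qed.

Lemma trihub_hypohamiltonian : hypohamiltonian trihub.
Proof.
split; first exact: trihub_nonhamiltonian.
case=> [[r|j]|]; last exact: ham_del_apex.
- by have [i ->] := hubP r; apply: ham_del_hub.
- by rewrite rimP; apply: ham_del_rim.
Qed.

Lemma trihub_K2_hamiltonian : K2_hamiltonian trihub.
Proof.
have hub_rim r j : res j == r ->
    hamiltonian (induced (~: [set (Some (inl r) : trihub); Some (inr j)])).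
  by move/eqP<-; rewrite rimP; apply: ham_del_hub_rim.
have rim_rim j :
    hamiltonian (induced (~: [set (Some (inr j) : trihub); Some (inr (j + 1)%R)])).
  by have := ham_del_rim_rim j; rewrite /rimv -natr1 natr_Zp.
have apex_hub r : hamiltonian (induced (~: [set apex; Some (inl r)])).
  by have [i ->] := hubP r; apply: ham_del_apex_hub.
case=> [[r|i]|] [[s|j]|]; rewrite /adj //=.
- exact: hub_rim.
- by move=> _; rewrite setUC; apply: apex_hub.
- by rewrite setUC; apply: hub_rim.
- by case/orP=> /eqP->; [|rewrite setUC]; apply: rim_rim.
Qed.

Lemma trihub_max_degree : max_degree trihub = m + 3.
Proof.
apply/eqP; rewrite eqn_leq -{2}(degree_hub 0) leq_bigmax andbT.
by apply/bigmax_leqP => x _; case: (vertexP 0 x) => [|k _|k _];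
  rewrite ?degree_apex ?degree_hub ?degree_rim ?leq_addl.
Qed.

Lemma trihub_size : #|edges trihub| = 6 * m + 15.
Proof.
have := sum_degree trihub; rewrite (bigD1 apex) //= degree_apex.
(* With the apex term removed, the sum runs over the image of [Some] and splits into hubs and rim: 3
   + 3(m + 3) + 3(3m + 6) = 2(6m + 15). *)
rewrite (reindex_omap Some id) => [|[x|]] //=.
rewrite (eq_bigl xpredT) => [|x]; last by rewrite eqxx.
rewrite big_sumType /= (eq_bigr (fun=> m + 3)) => [|r _]; last first.
  by have [i ->] := hubP r; apply: degree_hub.
rewrite [X in _ + (_ + X)](eq_bigr (fun=> 3)) => [|j _]; last first.
  by rewrite rimP degree_rim.
by rewrite !sum_nat_const !card_ord; lia.
Qed.

End Graph.

Theorem theorem4 (n : nat) (hn : 10 <= n) (hmod : n = 1 %[mod 3]) :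
  exists G : sgraph,
    [/\ connected_graph G /\ #|G| = n,
        #|edges G| = 2 * n - 5,
        max_degree G = (n - 1) %/ 3,
        hypohamiltonian G
      & K2_hamiltonian G].
Proof.
have -> : n = 3 * (n %/ 3 - 3) + 10 by lia.
move: (n %/ 3 - 3) => m; exists (trihub m).
split; [|rewrite trihub_size; lia|rewrite trihub_max_degree; lia| |].
- by split; [apply: trihub_connected|apply: card_trihub].
- exact: trihub_hypohamiltonian.
- exact: trihub_K2_hamiltonian.
Qed.
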